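(* Let $K\subset\mathbb{R}^2$ be a compact convex set with boundary of class $C^2$, with perimeter $L$, and let $w(R,\varphi)$ denote the visual angle of $K$ from the point $P(R,\varphi)$ (defined for $R$ large). Then $$2L=\lim_{R\to\infty}R\int_{0}^{2\pi}w(R,\varphi)\,d\varphi.$$
   Context: The support function of $K$ with respect to the origin is $p(\varphi)=\max_{(x,y)\in K}(x\cos\varphi+y\sin\varphi)$, a $2\pi$-periodic function. For $R>0$ large enough that the open disc of radius $R$ centered at the origin contains $K$, let $C_R$ be the circle of radius $R$ centered at the origin. The point $P(R,\varphi)\in C_R$ is the intersection of $C_R$ with the oriented support line of $K$ with outer normal $(\cos\varphi,\sin\varphi)$, taken in the direction $\varphi+\pi/2$; that is, $$P(R,\varphi)=p(\varphi)(\cos\varphi,\sin\varphi)+\sqrt{R^2-p(\varphi)^2}\,(-\sin\varphi,\cos\varphi).$$ The visual angle of $K$ from a point $P\notin K$ is the angle in $(0,\pi)$ under which $K$ is seen from $P$, i.e. the angle at $P$ of the smallest angular sector with vertex $P$ containing $K$ (the angle between the two support lines of $K$ through $P$). *)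

(* Defs.v *)
From HB Require Import structures.
From mathcomp Require Import all_boot all_order all_algebra.
From mathcomp Require Import all_classical all_reals all_analysis.

Set Implicit Arguments.
Unset Strict Implicit.
Unset Printing Implicit Defensive.

Import Order.TTheory GRing.Theory Num.Theory.
Import numFieldNormedType.Exports.

Local Open Scope classical_set_scope.
Local Open Scope ring_scope.

(** The plane is [R * R]. Its topology is the usual one, but the library norm
    on it is the sup norm, hence the separate [euclid_norm] used for lengths. *)

Definition euclid_norm (R : realType) (v : R * R) : R :=
  Num.sqrt (v.1 ^+ 2 + v.2 ^+ 2).

Definition boundary (R : realType) (K : set (R * R)) : set (R * R) :=
  closure K `\` K°.

Definition class_C (R : realType) (n : nat) (g : R -> R * R) : Prop :=
  (forall k t, (k < n)%N -> derivable (derive1n k g) t 1) /\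
  continuous (derive1n n g).

(** [g] runs exactly once over the boundary of [K] in each period [T]. Since [g]
    is a periodic function on the whole line, smoothness of [g] includes
    smoothness at the closing point. *)
Definition boundary_param (R : realType) (K : set (R * R)) (g : R -> R * R)
    (T : R) : Prop :=
  [/\ 0 < T, periodic g T, {in `[0, T[ &, injective g} & range g = boundary K].

(** This excludes points and segments: neither is its own boundary traversed by
    a simple closed curve. It also excludes the empty set. *)
Definition C2_boundary (R : realType) (K : set (R * R)) : Prop :=
  exists (g : R -> R * R) (T : R),
    [/\ boundary_param K g T, class_C 2 g & forall t, derive1 g t != 0].

(** The same for every C^1 parametrization, so [L] is unique. *)
Definition is_perimeter (R : realType) (K : set (R * R)) (L : R) : Prop :=
  exists (g : R -> R * R) (T : R),
    [/\ boundary_param K g T, class_C 1 g &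
        L = \int[lebesgue_measure]_(t in `[0, T]) euclid_norm (derive1 g t)].

(** For compact nonempty [K] the supremum is a maximum. *)
Definition support_fun (R : realType) (K : set (R * R)) (phi : R) : R :=
  sup [set q.1 * cos phi + q.2 * sin phi | q in K].

Definition support_point (R : realType) (K : set (R * R)) (r phi : R) : R * R :=
  let p := support_fun K phi in
  let s := Num.sqrt (r ^+ 2 - p ^+ 2) in
  (p * cos phi - s * sin phi, p * sin phi + s * cos phi).

Definition sector (R : realType) (P : R * R) (theta alpha : R) : set (R * R) :=
  [set q | exists rho t : R, [/\ 0 <= rho, theta <= t <= theta + alpha &
     q = (P.1 + rho * cos t, P.2 + rho * sin t)]].

(** Opening of the smallest sector with vertex [P] containing [K]; meaningful
    when [P] is outside the compact convex set [K]. *)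
Definition visual_angle (R : realType) (K : set (R * R)) (P : R * R) : R :=
  inf [set alpha | 0 < alpha < pi /\ exists theta, K `<=` sector P theta alpha].

(* Main.v *)
(** Seen from the direction [phi + pi / 2] at distance about [r], the set [K]
    has apparent width [W phi = p phi + p (phi + pi)], and elementary
    trigonometry gives, uniformly in [phi],
    [W phi / (r + 3 D) <= w r phi <= W phi / (r - 2 D)], where [D] bounds all
    coordinates of [K]. So the limit is the integral of [W] over a period.

    That this integral is [2 L] is Cauchy's formula. Write the length element as
    [|v| = 1/4 * int_0^(2 pi) |<v, u_phi>| dphi] and exchange the integrals: it
    remains to see that, for fixed [phi], the height [<g t, u_phi>] has total
    variation [2 W phi] over a period. A line that strictly separates two points
    of a convex set meets its boundary at most twice, so by the intermediate
    value theorem the height is monotone from its minimum to its maximum and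
    back. The same remark on the unit circle gives the formula for [|v|].

    The angle [w r] is measurable because [w r phi <= c] amounts to
    [p phi * cos c + p (phi + pi - c) <= sqrt (r^2 - (p phi)^2) * sin c]. *)

Require Import Defs.
From HB Require Import structures.
From mathcomp Require Import all_boot all_order all_algebra.
From mathcomp Require Import all_classical all_reals all_analysis.
From mathcomp Require Import measurable_realfun ring lra.

Import Order.TTheory GRing.Theory Num.Theory.
Import numFieldNormedType.Exports.

Local Open Scope classical_set_scope.
Local Open Scope ring_scope.

(** * Functions of one real variable *)

Lemma Rintegral_split (R : realType) (h : R -> R) (a b c : R) :
  a <= b <= c -> continuous h ->
  \int[lebesgue_measure]_(x in `[a, c]) h x =
  \int[lebesgue_measure]_(x in `[a, b]) h x +
  \int[lebesgue_measure]_(x in `[b, c]) h x.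
Proof.
move=> /andP[ab bc] ch.
have ih (x y : R) : lebesgue_measure.-integrable `[x, y] (EFin \o h).
  apply: continuous_compact_integrable; first exact: segment_compact.
  exact: continuous_subspaceT.
rewrite -(@Rintegral_itv_obnd_cbnd _ b); last first.
  apply: (integrableS _ _ _ (ih b c)) => //.
  by apply: subset_itvr; rewrite bnd_simp.
have := @Rintegral_itvB R h (BLeft a) (BRight c) b (ih a c).
rewrite !bnd_simp => /(_ ab bc) <-.
by rewrite addrC subrK.
Qed.

Lemma Rintegral_derive1 (R : realType) (f : R -> R) (a b : R) : a <= b ->
  (forall x, derivable f x 1) -> continuous (derive1 f) ->
  \int[lebesgue_measure]_(x in `[a, b]) (derive1 f) x = f b - f a.
Proof.
rewrite le_eqVlt => /predU1P[->|ab] df cf.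
  by rewrite subrr set_itv1 Rintegral_set1.
have contf : continuous f.
  by move=> x; apply: differentiable_continuous; exact/derivable1_diffP.
rewrite /Rintegral (@continuous_FTC2 _ (derive1 f) f)//.
- exact: continuous_subspaceT.
- split => //.
  + exact/cvg_at_right_filter/contf.
  + exact/cvg_at_left_filter/contf.
Qed.

Lemma ndecr_derive1_ge0 (R : realType) (f : R -> R) (a b x : R) :
  (forall x, derivable f x 1) -> {in `[a, b] &, {homo f : x y / x <= y}} ->
  x \in `]a, b[ -> 0 <= derive1 f x.
Proof.
move=> df hf xab; apply/ler_addgt0Pr => e e0.
(* [incr_derive1_ge0_itv] wants strict monotonicity, whence the slope [e]. *)
have dk (t : R) : is_derive t 1 (fun t : R => f t + e * t) (derive1 f t + e).
  apply: is_deriveD.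
    by apply: DeriveDef => //; rewrite derive1E.
  by apply: is_derive_eq; rewrite ?scaler0 ?addr0 /GRing.scale/= ?mulr1.
have <- : derive1 (fun t : R => f t + e * t) x = derive1 f x + e.
  by rewrite derive1E derive_val.
apply: (@incr_derive1_ge0_itv R _ true false a b) => //.
move=> s t sab tab st; apply: ler_ltD; last by rewrite ltr_pM2l.
exact: hf (ltW st).
Qed.

Lemma periodicz (R : realType) (V : Type) (f : R -> V) (T : R) (z : int) (u : R) :
  (forall u, f (u + T) = f u) -> f (u + T *~ z) = f u.
Proof.
move=> fT; have fn n t : f (t + T *+ n) = f t.
  by elim: n => [|n IH]; rewrite ?mulr0n ?addr0// mulrSr addrA fT.
case: z => n; first exact: fn.
by rewrite NegzE mulrNz -(fn n.+1 (u - _)) subrK.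
Qed.

Lemma itv_translate (R : realType) (T x : R) : 0 < T ->
  exists z : int, 0 <= x + T *~ z < T.
Proof.
move=> T0; exists (- Num.floor (x / T)).
have := floor_le (x / T); have := floorD1_gt (x / T).
move: (Num.floor _) => z; rewrite mulrNz -(mulrzr T) intrD.
rewrite ltr_pdivrMr// ler_pdivlMr// mulrDl mul1r [T * _]mulrC.
by move=> lt le; rewrite subr_ge0 le ltrBlDr addrC.
Qed.

Lemma periodic_itv (R : realType) (V : Type) (f : R -> V) (T x : R) :
  0 < T -> (forall u, f (u + T) = f u) -> exists2 y, y \in `[0, T[ & f y = f x.
Proof.
move=> T0 fT; have [z xz] := itv_translate R T x T0.
by exists (x + T *~ z); [rewrite in_itv|exact: periodicz].
Qed.

(** Both points are shifted by the multiple of [T] that brings [s] into [[0, T[]. Then [t] lands in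
    that interval or in the next one, where one more period is subtracted. *)
Lemma periodic_inj (R : realType) (V : Type) (f : R -> V) (T s t : R) :
  (forall u, f (u + T) = f u) -> {in `[0, T[ &, injective f} ->
  s < t -> t < s + T -> f s <> f t.
Proof.
move=> fT finj st ts; have T0 : 0 < T by lra.
have [z /andP[z0 zT]] := itv_translate R T s T0.
rewrite -(periodicz R V f T z s fT) -(periodicz R V f T z t fT) => fst.
have [tT|Tt] := ltP (t + T *~ z) T.
  suff : s + T *~ z = t + T *~ z by lra.
  by apply: finj fst; rewrite in_itv/=; apply/andP; split; lra.
suff : s + T *~ z = t + T *~ z - T by lra.
apply: finj; rewrite ?in_itv/=; try (apply/andP; split; lra).
by rewrite fst -[in RHS]fT subrK.
Qed.

(** If [f t < f s] for some [s < t] in the arc, the level [c] midway between these values is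
    attained before [s], between [s] and [t], and again between [b] and [a + T] on the way back to
    [f a]. That makes three times within one period. *)
Lemma ndecr_arc (R : realType) (f : R -> R) (a b T : R) :
  continuous f -> a <= b <= a + T -> f (a + T) = f a ->
  (forall t, f a <= f t <= f b) ->
  (forall t1 t2 t3, t1 < t2 -> t2 < t3 -> t3 < t1 + T ->
     f t1 = f t2 -> f t2 = f t3 -> f a < f t2 < f b -> False) ->
  {in `[a, b] &, {homo f : x y / x <= y}}.
Proof.
move=> cf /andP[ab baT] faT fab f3 s t.
rewrite !in_itv/= => /andP[as_ sb] /andP[at_ tb] st.
rewrite leNgt; apply/negP => fts.
have ivt (x y c : R) : x <= y -> f x < c < f y \/ f y < c < f x ->
    exists2 z, x <= z <= y & f z = c.
  move=> xy h; have [||z] := @IVT R f x y c xy.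
  - exact: continuous_subspaceT.
  - case: h => /andP[h1 h2]; have h := lt_trans h1 h2.
      by rewrite (min_idPl (ltW h)) (max_idPr (ltW h)) !ltW.
    by rewrite (min_idPr (ltW h)) (max_idPl (ltW h)) !ltW.
  - by rewrite in_itv/=; exists z.
pose c := (f s + f t) / 2.
have ftc : f t < c by rewrite /c; lra.
have fcs : c < f s by rewrite /c; lra.
have fac : f a < c by apply: le_lt_trans ftc; case/andP: (fab t).
have fcb : c < f b by apply: (lt_le_trans fcs); case/andP: (fab s).
have [t1 /andP[at1 t1s] ft1] : exists2 z, a <= z <= s & f z = c.
  by apply: ivt => //; left; rewrite fac.
have [t2 /andP[st2 t2t] ft2] : exists2 z, s <= z <= t & f z = c.
  by apply: ivt => //; right; rewrite fcs ftc.
have [t3 /andP[bt3 t3a] ft3] : exists2 z, b <= z <= a + T & f z = c.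
  by apply: ivt => //; right; rewrite faT fac.
have neq x y : f x != f y -> x <= y -> x < y.
  by move=> fxy; rewrite le_eqVlt => /predU1P[xy|//]; rewrite xy eqxx in fxy.
(* Only [t3 <= a + T] is known, so the bound [t3 < t1 + T] rests on this strict inequality. *)
have a1 : a < t1 by apply: neq at1; rewrite ft1 lt_eqF.
have s1 : t1 < s by apply: neq t1s; rewrite ft1 lt_eqF.
have t2t' : t2 < t by apply: neq t2t; rewrite ft2 gt_eqF.
apply: (f3 t1 t2 t3); rewrite ?ft1 ?ft2 ?ft3 ?fac ?fcb//; lra.
Qed.

Lemma derive1_periodic (R : realType) (f : R -> R) (T x : R) :
  (forall u, f (u + T) = f u) -> derive1 f (x + T) = derive1 f x.
Proof.
move=> fT; rewrite /derive1 fT.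
by under eq_fun do rewrite addrA fT.
Qed.

(** By [ndecr_arc], [f] climbs from its minimum at [a] to its maximum at [b] and descends until
    [a + T], so its total variation over a period is twice its oscillation. *)
Lemma Rintegral_abs_derive1 (R : realType) (f : R -> R) (T a b : R) :
  0 < T -> (forall u, f (u + T) = f u) ->
  (forall x, derivable f x 1) -> continuous (derive1 f) ->
  (forall t, f a <= f t <= f b) ->
  (forall t1 t2 t3, t1 < t2 -> t2 < t3 -> t3 < t1 + T ->
     f t1 = f t2 -> f t2 = f t3 -> f a < f t2 < f b -> False) ->
  \int[lebesgue_measure]_(t in `[0, T]) `|derive1 f t| = 2 * (f b - f a).
Proof.
move: a b => a0 b0 T0 fT df cdf fab0 f30.
have [a aT ea] := periodic_itv R R f T a0 T0 fT.
have [b bT eb] := periodic_itv R R f T b0 T0 fT.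
rewrite -ea -eb in fab0 f30 *.
(* Once [a] and [b] lie in [[0, T[], the case [b < a] reduces to the other one for [- f], whose
   minimum and maximum trade places. *)
wlog ab : f a b {a0 b0 ea eb} aT bT fT df cdf fab0 f30 / a <= b.
  move=> wlg; have [ab|/ltW ba] := leP a b; first exact: wlg.
  have dN : derive1 (- f) = - derive1 f.
    by apply/funext => x; rewrite !derive1E deriveN// -derive1E.
  have -> : 2 * (f b - f a) = 2 * ((- f) a - (- f) b).
    by rewrite -[(- f) a]/(- f a) -[(- f) b]/(- f b); ring.
  transitivity (\int[lebesgue_measure]_(t in `[0, T]) `|derive1 (- f) t|).
    by apply: eq_Rintegral => x _; rewrite dN normrN.
  apply: (wlg (- f) b a bT aT) => //.
  - by move=> u; rewrite /GRing.opp/= fT.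
  - by move=> x; apply: derivableN.
  - by rewrite dN => x; apply: cvgN; exact: cdf.
  - by move=> t; rewrite !lerN2 andbC.
  - move=> t1 t2 t3 t12 t23 t31 /oppr_inj e12 /oppr_inj e23.
    by rewrite !ltrN2 andbC; exact: f30 e12 e23.
have cf : continuous f.
  by move=> x; apply: differentiable_continuous; exact/derivable1_diffP.
move: aT bT; rewrite !in_itv/= => /andP[a0 aT] /andP[b0 bT].
have incr : {in `[a, b] &, {homo f : x y / x <= y}}.
  by apply: (@ndecr_arc R f a b T) => //; rewrite ab/=; lra.
have decr : {in `[b, a + T] &, {homo - f : x y / x <= y}}.
  apply: (@ndecr_arc R (- f) b (a + T) T) => //.
  - by move=> x; apply: cvgN; exact: cf.
  - by apply/andP; split; lra.
  - by rewrite -[LHS]/(- f _) fT.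
  - by move=> t; rewrite !lerN2 fT andbC.
  - move=> t1 t2 t3 t12 t23 t31 /oppr_inj e12 /oppr_inj e23.
    by rewrite !ltrN2 fT andbC; exact: f30 e12 e23.
(* Monotonicity gives the sign of the derivative only inside each arc; at the end points, which are
   extrema of [f], the derivative vanishes. *)
have da : derive1 f a = 0.
  rewrite derive1E; apply: derive_val.
  apply: (@derive1_at_min R f (a - 1) (a + 1)) => //; first lra.
    by rewrite in_itv/=; apply/andP; split; lra.
  by move=> t _; case/andP: (fab0 t).
have db : derive1 f b = 0.
  rewrite derive1E; apply: derive_val.
  apply: (@derive1_at_max R f (b - 1) (b + 1)) => //; first lra.
    by rewrite in_itv/=; apply/andP; split; lra.
  by move=> t _; case/andP: (fab0 t).
have pos t : a <= t <= b -> `|derive1 f t| = derive1 f t.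
  move=> /andP[]; rewrite le_eqVlt => /predU1P[<-|at_]; first by rewrite da normr0.
  rewrite le_eqVlt => /predU1P[->|tb]; first by rewrite db normr0.
  apply: ger0_norm; apply: ndecr_derive1_ge0 df incr _.
  by rewrite in_itv/= at_.
have neg t : b <= t <= a + T -> `|derive1 f t| = - derive1 f t.
  move=> /andP[]; rewrite le_eqVlt => /predU1P[<-|bt].
    by rewrite db normr0 oppr0.
  rewrite le_eqVlt => /predU1P[->|ta].
    by rewrite derive1_periodic// da normr0 oppr0.
  apply: ler0_norm; rewrite -oppr_ge0.
  have <- : derive1 (- f) t = - derive1 f t by rewrite !derive1E deriveN.
  apply: ndecr_derive1_ge0 decr _; first by move=> x; apply: derivableN.
  by rewrite in_itv/= bt.
have cn : continuous (fun t => `|derive1 f t|).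
  by move=> x; apply: cvg_norm; exact: cdf.
have iN x y : x <= y ->
    \int[lebesgue_measure]_(t in `[x, y]) - derive1 f t = f x - f y.
  move=> xy; rewrite -[RHS]opprB -(Rintegral_derive1 _ _ _ _ xy df cdf) -mulN1r.
  rewrite -RintegralZl//; first by apply: eq_Rintegral => t _; rewrite mulN1r.
  apply: continuous_compact_integrable; first exact: segment_compact.
  exact: continuous_subspaceT.
rewrite (Rintegral_split _ _ 0 a T)//; last by rewrite a0 ltW.
rewrite (Rintegral_split _ _ a b T)//; last by rewrite ab ltW.
(* Translation by [T] carries [[0, a]] into the descending arc [[b, a + T]]. *)
have -> : \int[lebesgue_measure]_(t in `[0, a]) `|derive1 f t| = f 0 - f a.
  rewrite -iN//; apply: eq_Rintegral => t; rewrite inE/= in_itv/= => /andP[t0 ta].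
  by rewrite -(derive1_periodic _ f T)// neg//; apply/andP; split; lra.
have -> : \int[lebesgue_measure]_(t in `[a, b]) `|derive1 f t| = f b - f a.
  rewrite -Rintegral_derive1//; apply: eq_Rintegral => t.
  by rewrite inE/= in_itv/=; exact: pos.
have -> : \int[lebesgue_measure]_(t in `[b, T]) `|derive1 f t| = f b - f T.
  rewrite -iN ?ltW//; apply: eq_Rintegral => t; rewrite inE/= in_itv/= => /andP[bt tT].
  by rewrite neg//; apply/andP; split; lra.
by have := fT 0; rewrite add0r => ->; ring.
Qed.

(** The angle is [acos (x / r)] or its opposite, according to the sign of [y]; at the origin any
    angle serves. *)
Lemma polar_coord (R : realType) (x y : R) : exists t,
  x = Num.sqrt (x ^+ 2 + y ^+ 2) * cos t /\
  y = Num.sqrt (x ^+ 2 + y ^+ 2) * sin t.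
Proof.
set r := Num.sqrt _.
have r0 : 0 <= r by exact: sqrtr_ge0.
have r2 : r ^+ 2 = x ^+ 2 + y ^+ 2 by rewrite sqr_sqrtr// addr_ge0// sqr_ge0.
have [r_eq0|rn0] := eqVneq r 0.
  exists 0; rewrite r_eq0 !mul0r.
  move: r2; rewrite r_eq0 expr0n/= => /esym/eqP.
  by rewrite paddr_eq0 ?sqr_ge0// !sqrf_eq0 => /andP[/eqP-> /eqP->].
have rp : 0 < r by rewrite lt_neqAle eq_sym rn0.
have e1 : (x / r) ^+ 2 + (y / r) ^+ 2 = 1.
  by rewrite !expr_div_n -mulrDl -r2 divff// expf_neq0.
have xr : -1 <= x / r <= 1.
  rewrite -ler_norml -(@ler_pXn2r _ 2)// ?nnegrE// expr1n real_normK ?num_real//.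
  by rewrite -e1 lerDl sqr_ge0.
have sE : sin (acos (x / r)) = `|y / r|.
  by rewrite sin_acos// -e1 addrAC subrr add0r sqrtr_sqr.
have cE : cos (acos (x / r)) = x / r by rewrite acosK// in_itv.
have [y0|y0] := leP 0 y.
  exists (acos (x / r)); rewrite cE sE ger0_norm ?divr_ge0//.
  by rewrite ![r * _]mulrC !divfK.
exists (- acos (x / r)); rewrite cosN sinN cE sE.
by rewrite ltr0_norm ?opprK ?pmulr_llt0 ?invr_gt0// ![r * _]mulrC !divfK.
Qed.

(** By the sum-to-product formula, equal sines at two points less than a period apart make the
    cosine vanish at their midpoint. The midpoints of [x], [y] and of [y], [z] are distinct and less
    than [pi] apart, too close for two zeros of the cosine. *)
Lemma sin_hits (R : realType) (x y z : R) :
  x < y -> y < z -> z < x + 2 * pi -> sin x = sin y -> sin y = sin z -> False.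
Proof.
move=> xy yz zx.
have mid (s t : R) : s < t -> t < s + 2 * pi -> sin s = sin t ->
    cos ((s + t) / 2) = 0.
  move=> st ts e; pose m := (s + t) / 2; pose d := (t - s) / 2.
  have : sin t - sin s = 2 * cos m * sin d.
    rewrite (_ : t = m + d) 1?(_ : s = m - d); try by rewrite /m /d; field.
    by rewrite sinD sinB; ring.
  rewrite e subrr => /esym/eqP; rewrite !mulf_eq0 pnatr_eq0/= => /orP[/eqP//|].
  by rewrite gt_eqF// sin_gt0_pi// /d; apply/andP; split; lra.
move=> exy eyz.
have c1 := mid _ _ xy (lt_trans yz zx) exy.
have c2 : cos ((y + z) / 2) = 0 by apply: mid eyz => //; lra.
have : sin ((y + z) / 2 - (x + y) / 2) = 0 by rewrite sinB c1 c2; ring.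
by apply/eqP; rewrite gt_eqF// sin_gt0_pi//; apply/andP; split; lra.
Qed.

(** The integrand is the absolute derivative of [F], a sine wave whose amplitude [r] is the norm of
    [v]; its total variation over a period is twice the oscillation [2 * r]. *)
Lemma Rintegral_abs_dot (R : realType) (v : R * R) :
  \int[lebesgue_measure]_(t in `[0, 2 * pi]) `|v.1 * cos t + v.2 * sin t| =
  4 * euclid_norm v.
Proof.
rewrite /euclid_norm; case: v => x y /=.
have [a []] := polar_coord R x y; set r := Num.sqrt _ => ex ey.
have r0 : 0 <= r by exact: sqrtr_ge0.
pose F t : R := x * sin t - y * cos t.
have FE t : F t = r * sin (t - a) by rewrite /F ex ey sinB; ring.
have dF (t : R) : is_derive t 1 F (x * cos t + y * sin t).
  by apply: is_derive_eq; rewrite /GRing.scale/=; ring.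
have dF1 : derive1 F = fun t => x * cos t + y * sin t.
  by apply/funext => t; rewrite derive1E derive_val.
have Fb t : - r <= F t <= r.
  by rewrite FE -ler_norml normrM ger0_norm// ler_piMr// sin_max.
have Fm : F (a - pi / 2) = - r.
  by rewrite FE addrAC subrr add0r sinN sin_pihalf mulrN1.
have FM : F (a + pi / 2) = r.
  by rewrite FE addrAC subrr add0r sin_pihalf mulr1.
transitivity (\int[lebesgue_measure]_(t in `[0, 2 * pi]) `|derive1 F t|).
  by rewrite dF1.
rewrite (@Rintegral_abs_derive1 _ F (2 * pi) (a - pi / 2) (a + pi / 2)).
- by rewrite Fm FM; ring.
- by rewrite mulr_gt0// pi_gt0.
- by move=> u; rewrite /F mulr_natl sinD2pi cosD2pi.
- by [].
- rewrite dF1 => t; apply: cvgD; apply: cvgM; first exact: cvg_cst.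
  + exact: continuous_cos.
  + exact: cvg_cst.
  + exact: continuous_sin.
- by move=> t; rewrite Fm FM.
- move=> t1 t2 t3 t12 t23 t31; rewrite Fm FM !FE => e12 e23 /andP[lt _].
  (* For [r = 0] no level lies strictly between [- r] and [r]; otherwise [r] cancels and only sines
     are compared. *)
  have rn0 : r != 0 by apply/eqP => re0; move: lt; rewrite re0 oppr0 mul0r ltxx.
  have/(mulfI rn0) e12' := e12; have /(mulfI rn0) e23' := e23.
  by apply: (@sin_hits _ (t1 - a) (t2 - a) (t3 - a)) => //; lra.
Qed.

(** * Heights and convexity *)

(** The coordinate along the unit normal of angle [phi], maximised over [K] by [support_fun]. At
    [phi + pi / 2] it becomes the coordinate along the support line. *)
Definition ht (R : realType) (phi : R) (q : R * R) : R :=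
  q.1 * cos phi + q.2 * sin phi.

(** Inverse to the pair of heights at [phi] and [phi + pi / 2]; [support_point] has this shape. *)
Definition frame_pt (R : realType) (phi h k : R) : R * R :=
  (h * cos phi - k * sin phi, h * sin phi + k * cos phi).

Lemma htpi2 (R : realType) (phi : R) (q : R * R) :
  ht R (phi + pi / 2) q = q.2 * cos phi - q.1 * sin phi.
Proof. by rewrite /ht cosDpihalf sinDpihalf; ring. Qed.

Lemma htpi (R : realType) (phi : R) (q : R * R) :
  ht R (phi + pi) q = - ht R phi q.
Proof. by rewrite /ht cosDpi sinDpi; ring. Qed.

Lemma ht_frame (R : realType) (phi h k : R) : ht R phi (frame_pt R phi h k) = h.
Proof.
rewrite /ht/=; transitivity (h * (cos phi ^+ 2 + sin phi ^+ 2)); first by ring.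
by rewrite cos2Dsin2 mulr1.
Qed.

Lemma ht_framepi2 (R : realType) (phi h k : R) :
  ht R (phi + pi / 2) (frame_pt R phi h k) = k.
Proof.
rewrite htpi2/=; transitivity (k * (cos phi ^+ 2 + sin phi ^+ 2)); first by ring.
by rewrite cos2Dsin2 mulr1.
Qed.

Lemma frame_ht (R : realType) (phi : R) (q : R * R) :
  frame_pt R phi (ht R phi q) (ht R (phi + pi / 2) q) = q.
Proof.
rewrite htpi2 /frame_pt /ht; case: q => x y /=; congr pair.
  transitivity (x * (cos phi ^+ 2 + sin phi ^+ 2)); first by ring.
  by rewrite cos2Dsin2 mulr1.
transitivity (y * (cos phi ^+ 2 + sin phi ^+ 2)); first by ring.
by rewrite cos2Dsin2 mulr1.
Qed.

Lemma continuous_ht (R : realType) (phi : R) : continuous (ht R phi).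
Proof.
move=> q; apply: cvgD; (apply: cvgM; last exact: cvg_cst).
  exact: cvg_fst.
exact: cvg_snd.
Qed.

Lemma convex_pair (R : realType) (K : set (R * R)) (p q : R * R) (l : R) :
  convex_set K -> K p -> K q -> 0 <= l <= 1 ->
  K ((1 - l) * p.1 + l * q.1, (1 - l) * p.2 + l * q.2).
Proof.
move=> cK Kp Kq l01.
have /(_ (Itv01 (andP l01).1 (andP l01).2)) := cK q p _ (mem_set Kq) (mem_set Kp).
rewrite inE /=; congr (K _); rewrite /conv/= addrC.
done.
Qed.

(** The coordinates of the rotated frame are linear, so a convex combination may be checked on
    them. *)
Lemma convex_ht (R : realType) (K : set (R * R)) (phi l : R) (p q r : R * R) :
  convex_set K -> K p -> K q -> 0 <= l <= 1 ->
  ht R phi r = (1 - l) * ht R phi p + l * ht R phi q ->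
  ht R (phi + pi / 2) r =
    (1 - l) * ht R (phi + pi / 2) p + l * ht R (phi + pi / 2) q ->
  K r.
Proof.
move=> cK Kp Kq l01 e1 e2.
rewrite -(frame_ht R phi r) e1 e2.
have := convex_pair R K p q l cK Kp Kq l01; congr K.
rewrite -[in LHS](frame_ht R phi p) -[in LHS](frame_ht R phi q) /frame_pt/=.
by congr pair; ring.
Qed.

(* The half neighbourhood of [y] on the side of [A] is contained in the triangle
   with vertices [x], [z], [A]. *)
Lemma near_convex_half (R : realType) (K : set (R * R)) (phi : R)
    (x y z A : R * R) : convex_set K -> K x -> K z -> K A ->
  ht R phi x = ht R phi y -> ht R phi z = ht R phi y ->
  ht R (phi + pi / 2) x < ht R (phi + pi / 2) y < ht R (phi + pi / 2) z ->
  ht R phi y < ht R phi A ->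
  \forall q \near y, ht R phi y <= ht R phi q -> K q.
Proof.
move=> cK Kx Kz KA ex ez /andP[xy yz] yA.
set u := ht R phi in ex ez yA *; set v := ht R (phi + pi / 2) in xy yz *.
(* The weight of [A] when [q] is split as [(1 - lam q) * m + lam q * A], with [m] on the line
   through [x] and [z]. *)
pose lam q := (u q - u y) / (u A - u y).
have clam : lam @ y --> (0 : R).
  rewrite (_ : 0 = lam y); last by rewrite /lam subrr mul0r.
  apply: cvgM; last exact: cvg_cst.
  by apply: cvgB; [exact: continuous_ht|exact: cvg_cst].
(* Up to the factor [1 - lam q], [b1] and [b2] measure how far [m] lies beyond [x] and short of [z].
   Both are positive at [y], hence near [y], which puts [m] on the chord. *)
pose b1 q := v q - lam q * v A - (1 - lam q) * v x.
pose b2 q := (1 - lam q) * v z - (v q - lam q * v A).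
have cv : v @ y --> v y by exact: continuous_ht.
have c1 : b1 @ y --> v y - 0 * v A - (1 - 0) * v x.
  apply: cvgB; [apply: cvgB => //|]; apply: cvgM => //; try exact: cvg_cst.
  by apply: cvgB => //; exact: cvg_cst.
have c2 : b2 @ y --> (1 - 0) * v z - (v y - 0 * v A).
  apply: cvgB; [|apply: cvgB => //]; apply: cvgM => //; try exact: cvg_cst.
  by apply: cvgB => //; exact: cvg_cst.
have n0 : \forall q \near y, lam q < 1 by apply: (cvgr_lt _ clam).
have n1 : \forall q \near y, 0 < b1 q by apply: (cvgr_gt _ c1); lra.
have n2 : \forall q \near y, 0 < b2 q by apply: (cvgr_gt _ c2); lra.
near=> q => uyq.
have q0 : lam q < 1 by near: q.
have q1 : 0 < b1 q by near: q.
have q2 : 0 < b2 q by near: q.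
have lam0 : 0 <= lam q by rewrite divr_ge0// subr_ge0// ltW.
pose c := (v q - lam q * v A) / (1 - lam q).
pose m := frame_pt R phi (u y) c.
have ln0 : 1 - lam q != 0 by rewrite gt_eqF// subr_gt0.
have um : u m = u y by exact: ht_frame.
have vm : v m = c by exact: ht_framepi2.
have xc : v x <= c.
  by rewrite ler_pdivlMr ?subr_gt0// mulrC; move: q1; rewrite /b1; lra.
have cz : c <= v z.
  by rewrite ler_pdivrMr ?subr_gt0// mulrC; move: q2; rewrite /b2; lra.
have zx : 0 < v z - v x by lra.
have Km : K m.
  apply: (@convex_ht R K phi ((c - v x) / (v z - v x)) x z) => //.
  - by rewrite divr_ge0 ?ler_pdivrMr ?subr_ge0//=; lra.
  - by rewrite -/u um ex ez; ring.
  - by rewrite -/v vm; field; rewrite gt_eqF.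
apply: (@convex_ht R K phi (lam q) m A) => //.
- by rewrite lam0 ltW.
- by rewrite -/u um /lam; field; rewrite gt_eqF// subr_gt0.
- by rewrite -/v vm /c; field.
Unshelve. all: by end_near. Qed.

(** Two half neighbourhoods make a full one. The second comes from the direction [phi + pi], which
    reverses all heights and thus exchanges [x] with [z] and [A] with [B]. *)
Lemma interior_convex_cross (R : realType) (K : set (R * R)) (phi : R)
    (x y z A B : R * R) : convex_set K -> K x -> K z -> K A -> K B ->
  ht R phi x = ht R phi y -> ht R phi z = ht R phi y ->
  ht R (phi + pi / 2) x < ht R (phi + pi / 2) y < ht R (phi + pi / 2) z ->
  ht R phi B < ht R phi y < ht R phi A -> K° y.
Proof.
move=> cK Kx Kz KA KB ex ez xyz /andP[By yA].
have h1 := near_convex_half R K phi x y z A cK Kx Kz KA ex ez xyz yA.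
have h2 := near_convex_half R K (phi + pi) z y x B cK Kz Kx KB.
rewrite addrAC !htpi in h2; move: h2; rewrite !ltrN2 => h2.
have {}h2 := h2 (congr1 -%R ez) (congr1 -%R ex).
rewrite andbC in xyz; have {h2 xyz} h2 := h2 xyz By.
apply: filterS2 h1 h2 => q k1 k2.
have [yq|qy] := leP (ht R phi y) (ht R phi q); first exact: k1.
by apply: k2; rewrite !htpi lerN2 ltW.
Qed.

(** A maximiser cannot be interior: a small step [e] in the direction [phi] would stay in [K] and
    raise the height by [e]. *)
Lemma ht_argmax_boundary (R : realType) (K : set (R * R)) (phi : R) :
  compact K -> K !=set0 ->
  exists2 q, boundary K q & forall p, K p -> ht R phi p <= ht R phi q.
Proof.
move=> cptK K0.
have [|q /set_mem Kq qmax] := compact_EVT_max (f := ht R phi) K0 cptK.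
  by apply: continuous_subspaceT; exact: continuous_ht.
exists q; last by move=> p Kp; apply: qmax; exact/mem_set.
split; first exact: subset_closure.
move=> Kq'.
pose line (e : R) := (q.1 + e * cos phi, q.2 + e * sin phi).
have c1 (c d : R) : c + e * d @[e --> (0 : R)] --> c.
  rewrite -[X in _ --> X]addr0 -[X in _ + X](mul0r d).
  apply: cvgD; first exact: cvg_cst.
  by apply: cvgM; [exact: cvg_id|exact: cvg_cst].
have cl : line e @[e --> (0 : R)] --> q.
  rewrite [q]surjective_pairing.
  exact: cvg_pair (c1 q.1 (cos phi)) (c1 q.2 (sin phi)).
have : \forall e \near 0^'+, K (line e) by apply: cvg_at_right_filter cl _ _.
move=> Kl.
have [e [e0 Ke]] : exists e, 0 < e /\ K (line e).
  near (0 : R)^'+ => e; exists e; split; first by near: e; exact: nbhs_right_gt.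
  by near: e.
have := qmax (line e) (mem_set Ke); rewrite leNgt => /negP; apply.
rewrite /ht /line/= -subr_gt0.
suff -> : (q.1 + e * cos phi) * cos phi + (q.2 + e * sin phi) * sin phi -
  (q.1 * cos phi + q.2 * sin phi) = e by [].
transitivity (e * (cos phi ^+ 2 + sin phi ^+ 2)); first by ring.
by rewrite cos2Dsin2 mulr1.
Unshelve. all: by end_near. Qed.

(** * Cauchy's formula *)

(** Tonelli's theorem applied to [h] cut off by the indicator of the rectangle. *)
Lemma Rintegral_fubini (R : realType) (h : R * R -> R) (a b c d : R) :
  (forall z, 0 <= h z) -> measurable_fun setT h ->
  (forall x, continuous (fun y => h (x, y))) ->
  (forall y, continuous (fun x => h (x, y))) ->
  \int[lebesgue_measure]_(x in `[a, b])
    \int[lebesgue_measure]_(y in `[c, d]) h (x, y) =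
  \int[lebesgue_measure]_(y in `[c, d])
    \int[lebesgue_measure]_(x in `[a, b]) h (x, y).
Proof.
move=> h0 mh cy cx.
(* The real integral is the extended one passed through [fine]; continuity makes the inner integrals
   finite, so [fine] loses nothing there. *)
have fint (k : R -> R) (u v : R) : continuous k ->
  (\int[lebesgue_measure]_(x in `[u, v]) k x)%:E =
  (\int[lebesgue_measure]_(x in `[u, v]) (k x)%:E)%E.
  move=> ck; rewrite /Rintegral fineK//; apply: integrable_fin_num => //.
  apply: continuous_compact_integrable; first exact: segment_compact.
  exact: continuous_subspaceT.
rewrite /Rintegral; congr fine.
under eq_integral do rewrite (fint _ c d (cy _)).
under [RHS]eq_integral do rewrite (fint _ a b (cx _)).
pose f (z : R * R) := (h z * (\1_`[a, b] z.1 * \1_`[c, d] z.2))%:E.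
transitivity (\int[lebesgue_measure]_x \int[lebesgue_measure]_y f (x, y))%E.
  rewrite integral_mkcond; apply: eq_integral => x _; rewrite patchE /f/= indicE.
  case: ifPn => xab; last first.
    by rewrite integral0_eq// => y _; rewrite mul0r mulr0.
  rewrite integral_mkcond; apply: eq_integral => y _; rewrite patchE indicE mul1r.
  by case: ifPn => _; rewrite ?mulr1 ?mulr0.
transitivity (\int[lebesgue_measure]_y \int[lebesgue_measure]_x f (x, y))%E; last first.
  rewrite [RHS]integral_mkcond; apply: eq_integral => y _; rewrite patchE /f/= indicE.
  case: ifPn => ycd; last first.
    by rewrite integral0_eq// => x _; rewrite !mulr0.
  rewrite [RHS]integral_mkcond; apply: eq_integral => x _; rewrite patchE indicE mulr1.
  by case: ifPn => _; rewrite ?mulr1 ?mulr0.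
apply: fubini_tonelli.
  apply/measurable_EFinP; apply: measurable_funM => //.
  apply: measurable_funM.
    by apply: measurableT_comp => //; exact: measurable_indic.
  by apply: measurableT_comp => //; exact: measurable_indic.
by move=> z; rewrite lee_fin !mulr_ge0// indicE ler0n.
Qed.

(** The height is linear and continuous, so it commutes with the limit of the difference
    quotients. *)
Lemma is_derive_ht (R : realType) (g : R -> R * R) (phi t : R) :
  derivable g t 1 -> is_derive t 1 (ht R phi \o g) (ht R phi (derive1 g t)).
Proof.
move=> dg.
have c : (fun h => h^-1 *: ((ht R phi \o g) (h *: 1 + t) - (ht R phi \o g) t)) @ 0^'
    --> ht R phi (derive1 g t).
  have -> : (fun h => h^-1 *: ((ht R phi \o g) (h *: 1 + t) - (ht R phi \o g) t)) =
     ht R phi \o (fun h => h^-1 *: (g (h *: 1 + t) - g t)).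
    by apply/funext => h; rewrite /ht /= /GRing.scale/=; ring.
  by rewrite derive1E; apply: continuous_cvg dg; exact: continuous_ht.
apply: DeriveDef; last exact: cvg_lim c.
by apply: cvgP c.
Qed.

Lemma compact_boundary (R : realType) (K : set (R * R)) :
  compact K -> boundary K = K `\` K°.
Proof.
move=> cK; rewrite /boundary; congr (_ `\` _).
by apply/esym/closure_id; apply: compact_closed => //; exact: norm_hausdorff.
Qed.

Lemma boundary_param_nonempty (R : realType) (K : set (R * R))
    (g : R -> R * R) (T : R) : compact K -> boundary_param K g T -> K !=set0.
Proof.
move=> cK [_ _ _ gK]; have : boundary K (g 0) by rewrite -gK; exists 0.
by rewrite compact_boundary// => -[Kg _]; exists (g 0).
Qed.

(** Attainment on the boundary is what lets a parametrization of the boundary reach the maximum. *)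
Lemma support_funP (R : realType) (K : set (R * R)) (phi : R) :
  compact K -> K !=set0 ->
  (forall p, K p -> ht R phi p <= support_fun K phi) /\
  exists2 q, boundary K q & ht R phi q = support_fun K phi.
Proof.
move=> cK K0; have [q bq qmax] := ht_argmax_boundary R K phi cK K0.
have Kq : K q by move: bq; rewrite compact_boundary// => -[].
have e : ht R phi q = support_fun K phi.
  apply/eqP; rewrite eq_le; apply/andP; split.
    apply: ub_le_sup; last by exists q.
    by exists (ht R phi q) => _ [p Kp <-]; exact: qmax.
  by apply: ge_sup; [exists (ht R phi q), q|move=> _ [p Kp <-]; exact: qmax].
by rewrite -e; split => //; exists q.
Qed.

(** Of three distinct points of [K] on one line, the middle one is interior by
    [interior_convex_cross], because [A] and [B] lie strictly on either side of the line. *)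
Lemma boundary_hits (R : realType) (K : set (R * R)) (phi : R)
    (x y z A B : R * R) : compact K -> convex_set K ->
  boundary K x -> boundary K y -> boundary K z -> K A -> K B ->
  x <> y -> y <> z -> x <> z ->
  ht R phi x = ht R phi y -> ht R phi y = ht R phi z ->
  ht R phi B < ht R phi y < ht R phi A -> False.
Proof.
move=> cK vK; rewrite compact_boundary// => -[Kx Ix] [Ky Iy] [Kz Iz] KA KB.
set v := ht R (phi + pi / 2).
have vinj p q : ht R phi p = ht R phi q -> p <> q -> v p != v q.
  move=> e pq; apply/eqP => e'; apply: pq.
  by rewrite -(frame_ht R phi p) -(frame_ht R phi q) e -/v e'.
move=> xy yz xz exy eyz lyA.
have := vinj _ _ exy xy; have := vinj _ _ eyz yz.
have := vinj _ _ (etrans exy eyz) xz.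
have cross p q r : K p -> K r -> ht R phi p = ht R phi q -> ht R phi r = ht R phi q ->
    ht R phi q = ht R phi y -> v p < v q < v r -> K° q.
  move=> Kp Kr e1 e2 e3 pqr.
  apply: (interior_convex_cross R K phi p q r A B) => //; by rewrite e3.
have exz := etrans exy eyz.
(* Six of the eight sign patterns are orderings with a middle point; the other two are cyclic. *)
rewrite !neq_lt => /orP[c1|c1] /orP[c2|c2] /orP[c3|c3].
- by apply: Iy; apply: (cross x y z); rewrite ?c3.
- by apply: Ix; apply: (cross y x z); rewrite ?c3.
- by apply: Iz; apply: (cross x z y); rewrite ?c1.
- by have := lt_trans (lt_trans c1 c2) c3; rewrite ltxx.
- by have := lt_trans (lt_trans c3 c2) c1; rewrite ltxx.
- by apply: Iz; apply: (cross y z x); rewrite ?c1// ?c2.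
- by apply: Ix; apply: (cross z x y); rewrite ?c1.
- by apply: Iy; apply: (cross z y x); rewrite ?c2.
Qed.

(** The height along [g] has maximum [support_fun K phi] and minimum [- support_fun K (phi + pi)]. A
    level met three times in a period would give three distinct boundary points on one line, since
    [g] is injective on a period. *)
Lemma Rintegral_abs_ht_derive1 (R : realType) (K : set (R * R)) (g : R -> R * R)
    (T phi : R) : compact K -> convex_set K ->
  boundary_param K g T -> class_C 1 g ->
  \int[lebesgue_measure]_(t in `[0, T]) `|ht R phi (derive1 g t)| =
  2 * (support_fun K phi + support_fun K (phi + pi)).
Proof.
move=> cK vK bp [dg cg]; have [T0 gT ginj gK] := bp.
have {}dg t : derivable g t 1 by exact: (dg 0%N).
have bg t : boundary K (g t) by rewrite -gK; exists t.
have K0 := boundary_param_nonempty R K g T cK bp.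
have [Mmax [q + qM]] := support_funP R K phi cK K0.
rewrite -gK => -[b _ gb]; rewrite -{}gb in qM.
have [mmin [q' + qm]] := support_funP R K (phi + pi) cK K0.
rewrite -gK => -[a _ ga]; rewrite -{}ga in qm.
have Kb t : K (g t) by move: (bg t); rewrite compact_boundary// => -[].
have dE (t : R) : is_derive t 1 (ht R phi \o g) (ht R phi (derive1 g t)).
  exact: is_derive_ht.
have dF : derive1 (ht R phi \o g) = fun t => ht R phi (derive1 g t).
  by apply/funext => t; rewrite derive1E derive_val.
rewrite -qM -qm htpi.
transitivity (\int[lebesgue_measure]_(t in `[0, T]) `|derive1 (ht R phi \o g) t|).
  by rewrite dF.
apply: (Rintegral_abs_derive1 R (ht R phi \o g) T a b) => //.
- by move=> u; rewrite /= gT.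
- rewrite dF => t; apply: continuous_comp; last exact: continuous_ht.
  exact: cg.
- move=> t /=; rewrite qM Mmax// andbT.
  by have := mmin _ (Kb t); rewrite -qm !htpi lerN2.
- move=> t1 t2 t3 t12 t23 t31 /= e12 e23 lt.
  apply: (boundary_hits R K phi (g t1) (g t2) (g t3) (g b) (g a)) => //.
  + by apply: (periodic_inj R _ g T) => //; lra.
  + by apply: (periodic_inj R _ g T) => //; lra.
  + by apply: (periodic_inj R _ g T) => //; lra.
Qed.

Lemma continuous_ht_angle (R : realType) (q : R * R) :
  continuous (fun phi => ht R phi q).
Proof.
move=> phi; apply: cvgD; (apply: cvgM; first exact: cvg_cst).
  exact: continuous_cos.
exact: continuous_sin.
Qed.

Lemma ht_bounded (R : realType) (K : set (R * R)) : compact K ->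
  exists2 D, 0 < D & forall phi psi q, K q ->
   `|ht R phi q| <= D /\
   `|ht R phi q - ht R psi q| <= D * (`|cos phi - cos psi| + `|sin phi - sin psi|).
Proof.
move=> cK; have [M [Mr Mb]] := compact_bounded cK.
(* [M + 1] is there because only numbers strictly above [M] are sure to bound [K]; the maximum with
   [1] makes [D] positive. *)
pose N := Num.max 1 (M + 1).
have N1 : 1 <= N by rewrite le_max lexx.
have MN : M < N by rewrite lt_max ltrDl ltr01 orbT.
have bnd q : K q -> `|q.1| <= N /\ `|q.2| <= N.
  move=> Kq; have : `|q| <= N := Mb N MN q Kq.
  by rewrite prod_normE/= ge_max => /andP[].
exists (N + N); first by lra.
move=> phi psi q /bnd[q1 q2]; split.
  rewrite (le_trans (ler_normD _ _))// !normrM lerD//.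
    by rewrite -[leRHS]mulr1 ler_pM// cos_max.
  by rewrite -[leRHS]mulr1 ler_pM// sin_max.
have -> : ht R phi q - ht R psi q =
    q.1 * (cos phi - cos psi) + q.2 * (sin phi - sin psi) by rewrite /ht; ring.
rewrite (le_trans (ler_normD _ _))// !normrM mulrDr lerD// ler_wpM2r//; lra.
Qed.

(** The heights of the points of [K] share one modulus of continuity in the angle, and their
    supremum inherits it: evaluating at a maximiser for [phi] bounds the difference from one side,
    and symmetry does the rest. *)
Lemma continuous_support_fun (R : realType) (K : set (R * R)) :
  compact K -> K !=set0 -> continuous (support_fun K).
Proof.
move=> cK K0; have [D D0 Db] := ht_bounded R K cK.
pose k (phi psi : R) := D * (`|cos phi - cos psi| + `|sin phi - sin psi|).
have up phi psi : support_fun K phi - support_fun K psi <= k phi psi.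
  have [_ [q + <-]] := support_funP R K phi cK K0.
  rewrite compact_boundary// => -[Kq _].
  have [/(_ q Kq) + _] := support_funP R K psi cK K0.
  have := (Db phi psi q Kq).2; rewrite -/(k phi psi) ler_norml => /andP[_].
  lra.
have ksym phi psi : k phi psi = k psi phi by rewrite /k distrC [X in _ + X]distrC.
have lip phi psi : `|support_fun K phi - support_fun K psi| <= k phi psi.
  rewrite ler_norml up andbT lerNl opprB ksym; exact: up.
move=> phi.
have k0 : k phi psi @[psi --> phi] --> 0.
  rewrite (_ : 0 = k phi phi); last by rewrite /k !subrr normr0 addr0 mulr0.
  apply: cvgM; first exact: cvg_cst.
  apply: cvgD; apply: cvg_norm; (apply: cvgB; first exact: cvg_cst).
    exact: continuous_cos.
  exact: continuous_sin.
apply/cvgrPdist_le => /= e e0.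
near=> psi; rewrite (le_trans (lip _ _))//.
by near: psi; apply: cvgr_le k0 _ _.
Unshelve. all: by end_near. Qed.

Lemma RintegralZl_continuous (R : realType) (k a b : R) (f : R -> R) :
  continuous f ->
  k * \int[lebesgue_measure]_(t in `[a, b]) f t =
  \int[lebesgue_measure]_(t in `[a, b]) (k * f t).
Proof.
move=> cf; rewrite RintegralZl//.
apply: continuous_compact_integrable; first exact: segment_compact.
exact: continuous_subspaceT.
Qed.

Lemma continuous_width (R : realType) (K : set (R * R)) :
  compact K -> K !=set0 ->
  continuous (fun phi => support_fun K phi + support_fun K (phi + pi)).
Proof.
move=> cK K0 phi; apply: cvgD; first exact: continuous_support_fun.
apply: (@continuous_comp _ _ _ (fun phi => phi + pi)).
  by apply: cvgD; [exact: cvg_id|exact: cvg_cst].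
exact: continuous_support_fun.
Qed.

Lemma Rintegral_width (R : realType) (K : set (R * R)) (L : R) :
  compact K -> convex_set K -> is_perimeter K L ->
  \int[lebesgue_measure]_(phi in `[0, 2 * pi])
    (support_fun K phi + support_fun K (phi + pi)) = 2 * L.
Proof.
move=> cK vK [g [T [bp C1 ->]]].
have K0 := boundary_param_nonempty R K g T cK bp.
have cg : continuous (derive1 g) := C1.2.
pose h (z : R * R) := `|ht R z.1 (derive1 g z.2)|.
have c1 : continuous (fun t => (derive1 g t).1).
  by move=> t; apply: continuous_comp; [exact: cg|exact: cvg_fst].
have c2 : continuous (fun t => (derive1 g t).2).
  by move=> t; apply: continuous_comp; [exact: cg|exact: cvg_snd].
have cW := continuous_width R K cK K0.
have cn : continuous (fun t => euclid_norm (derive1 g t)).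
  move=> t; rewrite /euclid_norm; apply: continuous_comp; last exact: sqrt_continuous.
  by apply: cvgD; apply: cvgM; try exact: c1; exact: c2.
have two0 : (2 : R) != 0 by rewrite pnatr_eq0.
(* After doubling, both sides are iterated integrals of [h]: over [t] it gives twice the width, over
   [phi] four times the speed. *)
apply: (mulfI two0); rewrite [RHS]mulrA -natrM.
transitivity (\int[lebesgue_measure]_(phi in `[0, 2 * pi])
    \int[lebesgue_measure]_(t in `[0, T]) h (phi, t)).
  rewrite (RintegralZl_continuous R 2 0 (2 * pi) _ cW); apply: eq_Rintegral => phi _.
  by rewrite -(Rintegral_abs_ht_derive1 R K g T phi cK vK bp C1).
rewrite (RintegralZl_continuous R _ 0 T _ cn).
transitivity (\int[lebesgue_measure]_(t in `[0, T])
    \int[lebesgue_measure]_(phi in `[0, 2 * pi]) h (phi, t)); last first.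
  by apply: eq_Rintegral => t _; rewrite -Rintegral_abs_dot.
apply: (Rintegral_fubini R h 0 (2 * pi) 0 T).
- by move=> z; exact: normr_ge0.
- apply: measurableT_comp => //; apply: measurable_funD; apply: measurable_funM.
  + apply: (@measurableT_comp _ _ _ _ _ _ (fun t => (derive1 g t).1) _ snd) => //.
    exact: continuous_measurable_fun.
  + apply: measurableT_comp => //.
    by apply: continuous_measurable_fun; exact: continuous_cos.
  + apply: (@measurableT_comp _ _ _ _ _ _ (fun t => (derive1 g t).2) _ snd) => //.
    exact: continuous_measurable_fun.
  + apply: measurableT_comp => //.
    by apply: continuous_measurable_fun; exact: continuous_sin.
- move=> phi t; apply: cvg_norm.
  by apply: (@continuous_comp _ _ _ (derive1 g) (ht R phi));
    [exact: cg|exact: continuous_ht].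
- by move=> t phi; apply: cvg_norm; exact: continuous_ht_angle.
Qed.

(** * The visual angle *)

(** Mean value theorem on [[0, c]]: [sin c] is [c] times an intermediate cosine, which lies between
    [cos c] and [1], and [1 - cos c] is [c] times an intermediate sine. *)
Lemma sin_cos_bounds (R : realType) (c : R) : 0 <= c <= pi / 2 ->
  [/\ sin c <= c, c * cos c <= sin c & 1 - c <= cos c].
Proof.
move=> /andP[c0 cpi].
have pi0 := pi_gt0 R.
have [x + ex] := @MVT_segment R sin cos 0 c c0 (fun x _ => is_derive_sin x)
  (continuous_subspaceT (@continuous_sin R)).
rewrite in_itv/= => /andP[x0 xc].
have [y + ey] := @MVT_segment R cos (fun x => - sin x) 0 c c0
  (fun x _ => is_derive_cos x) (continuous_subspaceT (@continuous_cos R)).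
rewrite in_itv/= => /andP[y0 yc].
move: ex ey; rewrite sin0 cos0 !subr0 => ex ey.
have cx : cos c <= cos x.
  rewrite leNgt ltr_cos ?in_itv/= -?leNgt//; apply/andP; split; lra.
split.
- by rewrite ex ler_piMl// cos_le1.
- by rewrite ex mulrC ler_wpM2r.
- have : cos c = 1 - sin y * c by lra.
  by move=> ->; rewrite lerB// ler_piMl// sin_le1.
Qed.

Section Visual_angle.
Variables (R : realType) (K : set (R * R)).
Hypotheses (cK : compact K) (K0 : K !=set0).

Let p := support_fun K.
Let s r phi := Num.sqrt (r ^+ 2 - p phi ^+ 2).
Let v phi q := ht R (phi + pi / 2) q.

Let in_sector r phi c :=
  exists theta, K `<=` sector (support_point K r phi) theta c.

(** With [a] the distance of [q] to the support line and [b] its distance to the vertex measured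
    along that line, [q] is seen at angle [atan (a / b)] from the line; the condition says that this
    angle is at most [c]. *)
Lemma in_sectorP (r phi c : R) : 0 <= c <= pi / 2 ->
  (forall q, K q -> v phi q < s r phi) ->
  in_sector r phi c <-> forall q, K q ->
    (p phi - ht R phi q) * cos c <= (s r phi - v phi q) * sin c.
Proof.
move=> /andP[c0 cpi] vs; have pi0 := pi_gt0 R.
have [pmax [q0 + eq0]] := support_funP R K phi cK K0.
rewrite compact_boundary// => -[Kq0 _].
have PE : support_point K r phi = frame_pt R phi (p phi) (s r phi) by [].
split=> [[theta Ksec] q Kq|h].
  have sec q' : K q' -> exists rho t, [/\ 0 <= rho, theta <= t + phi <= theta + c,
      p phi - ht R phi q' = - (rho * cos t) & s r phi - v phi q' = - (rho * sin t)].
    move=> /Ksec [rho [t [rho0 tth ->]]]; exists rho, (t - phi).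
    rewrite subrK PE; split => //.
      rewrite /ht cosB -[X in X - _](ht_frame R phi _ (s r phi)) /ht/=; ring.
    rewrite /v htpi2 sinB -[X in X - _](ht_framepi2 R phi (p phi)) htpi2/=; ring.
  have [rho [t [rho0 /andP[t1 t2] ea eb]]] := sec q Kq.
  (* The point [q0] lies on the support line, so a sector containing [K] has this direction too. The
     two viewing angles differ by at most [c], hence [t + c - t'] lies in [[0, 2 * c]], where the
     sine is nonnegative. *)
  have [rho' [t' [rho0' /andP[t1' t2'] ea' eb']]] := sec q0 Kq0.
  have b0 : 0 < s r phi - v phi q0 by rewrite subr_gt0 vs.
  rewrite -subr_le0 -(pmulr_rle0 _ b0).
  have e0 : rho' * cos t' = 0 by apply/eqP; rewrite -oppr_eq0 -ea' eq0 subrr.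
  have -> : (s r phi - v phi q0) * ((p phi - ht R phi q) * cos c -
      (s r phi - v phi q) * sin c) = - (rho * rho' * sin (t + c - t')).
    rewrite ea eb eb' sinB sinD cosD.
    transitivity (rho * rho' * sin t' * (cos t * cos c - sin t * sin c)
      - rho * (rho' * cos t') * (sin t * cos c + cos t * sin c)); last by ring.
    by rewrite e0; ring.
  rewrite oppr_le0 mulr_ge0 ?mulr_ge0// sin_ge0_pi//.
  by apply/andP; split; lra.
(* From the vertex, [K] is seen looking back along the support line, in direction [phi - pi / 2];
   the sector opens from there towards the side of [K]. *)
exists (phi - pi / 2 - c) => q Kq.
set a := p phi - ht R phi q; set b := s r phi - v phi q.
have b0 : 0 < b by rewrite subr_gt0 vs.
have a0 : 0 <= a by rewrite subr_ge0; exact: pmax.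
pose t := atan (a / b).
have t0 : 0 <= t by rewrite -(@atan0 R) le_atan// divr_ge0// ltW.
have tpi : t < pi / 2 by exact: atan_ltpi2.
have ct : 0 < cos t by apply: cos_gt0_pihalf; apply/andP; split; lra.
pose rho := b / cos t.
have rho0 : 0 < rho by rewrite divr_gt0.
have eb : b = rho * cos t by rewrite /rho divfK// gt_eqF.
have ea : a = rho * sin t.
  have : tan t = a / b by rewrite /t atanK.
  rewrite /tan => /(congr1 ( *%R^~ b)); rewrite divfK ?gt_eqF// => <-.
  by rewrite /rho; ring.
have tc : t <= c.
  rewrite leNgt; apply/negP => ct'.
  have := h q Kq; rewrite -/a -/b ea eb -subr_le0.
  have -> : rho * sin t * cos c - rho * cos t * sin c = rho * sin (t - c).
    by rewrite sinB; ring.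
  rewrite leNgt pmulr_rgt0// sin_gt0_pi//.
  by apply/andP; split; lra.
exists rho, (phi - t - pi / 2); split; first exact: ltW.
  by apply/andP; split; lra.
rewrite cosBpihalf sinBpihalf sinB cosB PE -[LHS](frame_ht R phi) /frame_pt/=.
have -> : ht R phi q = p phi - rho * sin t by rewrite -ea /a; ring.
have -> : ht R (phi + pi / 2) q = s r phi - rho * cos t.
  by rewrite -eb /b /v; ring.
by congr pair; ring.
Qed.

(** The condition on [q] is an upper bound on its height in direction [phi + pi - c], so only the
    maximum matters. *)
Lemma in_sectorE (r phi c : R) : 0 <= c <= pi / 2 ->
  (forall q, K q -> v phi q < s r phi) ->
  in_sector r phi c <-> p phi * cos c + p (phi + pi - c) <= s r phi * sin c.
Proof.
move=> c0 vs; rewrite in_sectorP//.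
have e q : (p phi - ht R phi q) * cos c <= (s r phi - v phi q) * sin c =
    (p phi * cos c + ht R (phi + pi - c) q <= s r phi * sin c).
  rewrite -subr_ge0 -[in RHS]subr_ge0; congr (_ <= _).
  rewrite /v htpi2 /ht cosB sinB cosDpi sinDpi; ring.
have [pmax [q + eq]] := support_funP R K (phi + pi - c) cK K0.
rewrite compact_boundary// => -[Kq _].
split=> [h|h q' Kq']; first by rewrite /p -eq -e; exact: h.
by rewrite e (le_trans _ h)// lerD2l; exact: pmax.
Qed.

(** * Bounds and measurability of the visual angle at a fixed radius *)

Variables (D : R).
Hypotheses (D0 : 0 < D) (hD : forall phi q, K q -> `|ht R phi q| <= D).
Variable r : R.
Hypothesis rD : 2 * D < r.

Let W phi := p phi + p (phi + pi).
Let w phi := visual_angle K (support_point K r phi).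

Lemma support_fun_bound phi : `|p phi| <= D.
Proof.
have [_ [q + eq]] := support_funP R K phi cK K0.
by rewrite compact_boundary// /p -eq => -[Kq _]; exact: hD.
Qed.

Lemma sqrt_bound phi : r - D <= s r phi <= r.
Proof.
(* [lra] ignores section hypotheses, hence these local copies. *)
have D1 := D0; have rD1 := rD.
have := support_fun_bound phi; rewrite ler_norml => /andP[p1 p2].
have p2D : p phi ^+ 2 <= D ^+ 2 by rewrite -subr_ge0 subr_sqr mulr_ge0//; lra.
apply/andP; split.
  have rD0 : 0 <= r - D by lra.
  (* The difference of [r ^+ 2 - D ^+ 2] and [(r - D) ^+ 2] is [2 * D * (r - D)], which is
     nonnegative. *)
  rewrite -(ger0_norm rD0) -sqrtr_sqr ler_wsqrtr//.
  have : 0 <= (r - D) * D by rewrite mulr_ge0//; lra.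
  by move: p2D; rewrite !expr2; lra.
have r0 : 0 <= r by lra.
rewrite -[leRHS](ger0_norm r0) -sqrtr_sqr ler_wsqrtr//.
by rewrite gerBl sqr_ge0.
Qed.

Lemma depth_bound phi q : K q -> r - 2 * D <= s r phi - v phi q <= r + D.
Proof.
have D1 := D0; have rD1 := rD.
move=> Kq; have := hD (phi + pi / 2) q Kq; rewrite ler_norml => /andP[v1 v2].
by have /andP[s1 s2] := sqrt_bound phi; rewrite /v; apply/andP; split; lra.
Qed.

Lemma below_sqrt phi q : K q -> v phi q < s r phi.
Proof.
have D1 := D0; have rD1 := rD.
by move=> /(depth_bound phi)/andP[h _]; lra.
Qed.

Lemma width_itv phi : 0 <= W phi <= 2 * D.
Proof.
have [q Kq] := K0.
have [/(_ q Kq) h1 _] := support_funP R K phi cK K0.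
have [/(_ q Kq) + _] := support_funP R K (phi + pi) cK K0.
rewrite htpi => h2.
have := support_fun_bound phi; rewrite ler_norml => /andP[_ h3].
have := support_fun_bound (phi + pi); rewrite ler_norml => /andP[_ h4].
by rewrite /W; apply/andP; split; rewrite /p in h3 h4 *; lra.
Qed.

Lemma offset_le_width phi q : K q -> 0 <= p phi - ht R phi q <= W phi.
Proof.
move=> Kq; have [/(_ q Kq) h1 _] := support_funP R K phi cK K0.
have [/(_ q Kq) + _] := support_funP R K (phi + pi) cK K0.
by rewrite htpi => h2; rewrite /W /p; apply/andP; split; lra.
Qed.

Let opening phi := [set c | 0 < c < pi /\ in_sector r phi c].

(** A right angle always suffices, so the infimum is never taken over the empty set. *)
Lemma opening_pihalf phi : opening phi (pi / 2).
Proof.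
have pi0 := pi_gt0 R; split; first by apply/andP; split; lra.
apply/(in_sectorP).
- by apply/andP; split; lra.
- by move=> q; exact: below_sqrt.
move=> q Kq; rewrite cos_pihalf sin_pihalf mulr0 mulr1.
by have := below_sqrt phi q Kq; rewrite subr_ge0 => /ltW.
Qed.

Lemma has_lbound_opening phi : has_lbound (opening phi).
Proof. by exists 0 => c [/andP[/ltW]]. Qed.

Lemma visual_angle_le_opening phi c : opening phi c -> w phi <= c.
Proof. by move=> oc; apply: ge_inf => //; exact: has_lbound_opening. Qed.

Lemma visual_angle_pihalf phi : w phi <= pi / 2.
Proof. exact/visual_angle_le_opening/opening_pihalf. Qed.

(** Every [c] in []0, pi / 2]] above the bound is admissible: the offset is at most [W phi], the
    depth at least [r - 2 * D], and [c * cos c <= sin c]. *)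
Lemma visual_angle_ub phi : w phi <= W phi / (r - 2 * D).
Proof.
have D1 := D0; have rD1 := rD.
have pi0 := pi_gt0 R; have /andP[W0 WD] := width_itv phi.
have r0 : 0 < r - 2 * D by lra.
(* The slack [e] keeps [c] positive even if the width is zero. *)
apply/ler_addgt0Pr => e e0; set c := _ + e.
have Wc : W phi / (r - 2 * D) < c by rewrite ltrDl.
have c0 : 0 < c by apply: le_lt_trans Wc; rewrite divr_ge0// ltW.
have [cpi|/ltW pic] := leP c (pi / 2); last first.
  exact: le_trans (visual_angle_pihalf phi) pic.
have c0pi : 0 <= c <= pi / 2 by rewrite ltW.
have [sc cc _] := sin_cos_bounds R c c0pi.
have cos0 : 0 <= cos c by apply: cos_ge0_pihalf; apply/andP; split; lra.
have sin0 : 0 <= sin c by apply: sin_ge0_pi; apply/andP; split; lra.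
apply: visual_angle_le_opening; split; first by apply/andP; split; lra.
apply/(in_sectorP) => //; first by move=> q; exact: below_sqrt.
move=> q Kq.
have /andP[a0 aW] := offset_le_width phi q Kq.
have /andP[br _] := depth_bound phi q Kq.
apply: (@le_trans _ _ ((r - 2 * D) * (c * cos c))).
  rewrite mulrA ler_wpM2r// (le_trans aW)// mulrC -ler_pdivrMr//.
  exact: ltW.
by rewrite ler_pM// ?(ltW r0)// mulr_ge0// ltW.
Qed.

(** At a point farthest from the support line the offset is exactly [W phi]. An admissible [c] then
    satisfies [W phi * (1 - c) <= (r + D) * c], and [W phi <= 2 * D] turns [r + D] into
    [r + 3 * D]. *)
Lemma visual_angle_lb phi : W phi / (r + 3 * D) <= w phi.
Proof.
have D1 := D0; have rD1 := rD.
have pi0 := pi_gt0 R; have /andP[W0 WD] := width_itv phi.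
have r0 : 0 < r + 3 * D by lra.
apply: lb_le_inf; first by exists (pi / 2); exact: opening_pihalf.
move=> c [/andP[c0 _] sec].
have [cpi|/ltW pic] := leP c (pi / 2); last first.
  apply: le_trans pic; rewrite ler_pdivrMr//.
  have : 1 <= (pi : R) / 2 by exact: pihalf_ge1.
  by move=> p1; rewrite (le_trans (_ : _ <= 1 * (r + 3 * D)))// ?ler_pM2r// mul1r; lra.
have c0pi : 0 <= c <= pi / 2 by rewrite ltW.
have [sc _ cc] := sin_cos_bounds R c c0pi.
have [_ [q + eq]] := support_funP R K (phi + pi) cK K0.
rewrite compact_boundary// => -[Kq _].
have /(in_sectorP r phi c c0pi) := sec.
move=> /(_ (fun q => below_sqrt phi q))/(_ q Kq).
have -> : support_fun K phi - ht R phi q = W phi.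
  by rewrite /W /p -eq htpi.
move=> h.
have /andP[b1 b2] := depth_bound phi q Kq.
have h1 : W phi * (1 - c) <= W phi * cos c by rewrite ler_wpM2l.
have h2 : (s r phi - v phi q) * sin c <= (r + D) * c.
  rewrite (@le_trans _ _ ((s r phi - v phi q) * c))//.
    by rewrite ler_wpM2l//; lra.
  by rewrite ler_wpM2r// ltW.
have h3 : W phi * c <= 2 * D * c by rewrite ler_wpM2r// ltW.
have := le_trans h1 (le_trans h h2); rewrite mulrBr mulr1 => h4.
by rewrite ler_pdivrMr//; lra.
Qed.

(** A sector may be widened, so an admissible angle below [y] yields one of the form
    [y - n.+1%:R^-1]. This countable family serves for measurability. *)
Lemma visual_angle_ltP phi y : 0 < y <= pi / 2 ->
  w phi < y <-> exists n : nat, 0 < y - n.+1%:R^-1 /\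
    p phi * cos (y - n.+1%:R^-1) + p (phi + pi - (y - n.+1%:R^-1)) <=
    s r phi * sin (y - n.+1%:R^-1).
Proof.
have pi0 := pi_gt0 R; move=> /andP[y0 ypi]; split.
  move=> wy; have [||c [/andP[c0 _] [th secc]] cy] := @inf_lt R (opening phi) y.
  - by exists (pi / 2); exact: opening_pihalf.
  - exact: wy.
  have [n nc] : exists n : nat, n.+1%:R^-1 < y - c.
    have yc : 0 < y - c by lra.
    by exists (Num.truncn (y - c)^-1); rewrite invf_plt ?posrE ?truncnS_gt.
  exists n; have n0 : 0 < n.+1%:R^-1 :> R by rewrite invr_gt0.
  move: n.+1%:R^-1 nc n0 => e nc n0; have cR := c0.
  split; first by lra.
  apply/(in_sectorE); first by apply/andP; split; lra.
    by move=> q; exact: below_sqrt.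
  exists th => q Kq; have [rho [t [rho0 /andP[t1 t2] ->]]] := secc q Kq.
  by exists rho, t; split => //; apply/andP; split; lra.
move=> [n [c0 /(in_sectorE) sec]].
have n0 : 0 < n.+1%:R^-1 :> R by rewrite invr_gt0.
move: n.+1%:R^-1 n0 c0 sec => e n0 c0 sec.
apply: (@le_lt_trans _ _ (y - e)); last by lra.
apply: visual_angle_le_opening; split; first by apply/andP; split; lra.
apply: sec; first by apply/andP; split; lra.
by move=> q; exact: below_sqrt.
Qed.

(** The preimage of the ray below [y] is empty for [y <= 0] and everything for [y > pi / 2]. In
    between it is a countable union of sets comparing two continuous functions. *)
Lemma measurable_visual_angle : measurable_fun setT w.
Proof.
have D1 := D0; have rD1 := rD.
have pi0 := pi_gt0 R.
apply: (measurability _ (RGenInftyO.measurableE R)) => _ [_ [y ->]] <-.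
rewrite setTI.
have [y0|y0] := leP y 0.
  rewrite (_ : _ @^-1` _ = set0); first exact: measurable0.
  rewrite -subset0 => phi /=; rewrite in_itv/= => wy.
  have /andP[W0 _] := width_itv phi.
  have : 0 <= W phi / (r + 3 * D) by rewrite divr_ge0//; lra.
  by have := visual_angle_lb phi; lra.
have [ypi|ypi] := leP y (pi / 2); last first.
  rewrite (_ : _ @^-1` _ = setT); first exact: measurableT.
  apply/seteqP; split => // phi _ /=; rewrite in_itv/=.
  exact: le_lt_trans (visual_angle_pihalf phi) ypi.
have cp : continuous p by exact: continuous_support_fun.
pose A (n : nat) := [set phi | 0 < y - n.+1%:R^-1 /\
    p phi * cos (y - n.+1%:R^-1) + p (phi + pi - (y - n.+1%:R^-1)) <=
    s r phi * sin (y - n.+1%:R^-1)].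
rewrite (_ : _ @^-1` _ = \bigcup_n A n); last first.
  apply/seteqP; split => phi /=; rewrite in_itv/=.
    by rewrite visual_angle_ltP ?y0// => -[n]; exists n.
  by move=> [n _ h]; rewrite visual_angle_ltP ?y0//; exists n.
apply: bigcupT_measurable => n; rewrite /A.
have [c0|c0] := ltP 0 (y - n.+1%:R^-1); last first.
  rewrite (_ : [set _ | _] = set0); first exact: measurable0.
  by rewrite -subset0 => phi /= [].
set c := y - _ in c0 *.
rewrite (_ : [set _ | _] = setT `&`
    [set phi | p phi * cos c + p (phi + pi - c) <= s r phi * sin c]); last first.
  by apply/seteqP; split => phi /= [].
apply: measurable_fun_le => //; apply: continuous_measurable_fun => phi.
- apply: cvgD; first by apply: cvgM; [exact: cp|exact: cvg_cst].
  apply: (@continuous_comp _ _ _ (fun phi => phi + pi - c)); last exact: cp.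
  by do 2 (apply: cvgD; last exact: cvg_cst); exact: cvg_id.
- apply: cvgM; last exact: cvg_cst.
  apply: (@continuous_comp _ _ _ (fun phi => r ^+ 2 - p phi ^+ 2)).
    by apply: cvgB; [exact: cvg_cst|apply: cvgM; exact: cp].
  exact: sqrt_continuous.
Qed.

Lemma integrable_visual_angle (a b : R) :
  lebesgue_measure.-integrable `[a, b] (EFin \o w).
Proof.
have D1 := D0; have rD1 := rD.
apply: measurable_bounded_integrable => //.
- exact: compact_finite_measure (@segment_compact _ _ _).
- exact: measurable_funTS measurable_visual_angle.
- exists (pi / 2); split; first exact: num_real.
  move=> x xpi phi _ /=; rewrite ger0_norm.
    exact: le_trans (visual_angle_pihalf phi) (ltW xpi).
  apply: le_trans (visual_angle_lb phi).
  have /andP[W0 _] := width_itv phi.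
  by rewrite divr_ge0//; lra.
Qed.

End Visual_angle.

(** * Integration of the bounds and the limit for large radius *)

Lemma le_Rintegral_visual_angle (R : realType) (K : set (R * R)) (D r L : R) :
  compact K -> convex_set K -> K !=set0 -> is_perimeter K L -> 0 < D ->
  (forall phi q, K q -> `|ht R phi q| <= D) -> 2 * D < r ->
  (r + 3 * D)^-1 * (2 * L) <=
    \int[lebesgue_measure]_(phi in `[0, 2 * pi])
      visual_angle K (support_point K r phi) <=
  (r - 2 * D)^-1 * (2 * L).
Proof.
move=> cK vK K0 KL D0 hD rD.
have cW := continuous_width R K cK K0.
have iW (k : R) : lebesgue_measure.-integrable `[0, 2 * pi]
    (EFin \o (fun phi => k * (support_fun K phi + support_fun K (phi + pi)))).
  apply: continuous_compact_integrable; first exact: segment_compact.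
  apply: continuous_subspaceT => phi.
  by apply: cvgM; [exact: cvg_cst|exact: cW].
have iw := integrable_visual_angle R K cK K0 D D0 hD r rD 0 (2 * pi).
rewrite -(Rintegral_width R K L cK vK KL).
rewrite !(RintegralZl_continuous R _ 0 (2 * pi) _ cW).
apply/andP; split; apply: le_Rintegral => // phi _; rewrite mulrC.
- exact: visual_angle_lb.
- exact: visual_angle_ub.
Qed.

Theorem theorem3p1 (R : realType) (K : set (R * R)) (L : R)
    (K_compact : compact K) (K_convex : convex_set K)
    (K_C2 : C2_boundary K) (K_perimeter : is_perimeter K L) :
  let w (r phi : R) := visual_angle K (support_point K r phi) in
  (\forall r \near +oo, lebesgue_measure.-integrable `[0, 2 * pi] (EFin \o w r))
  /\ r * \int[lebesgue_measure]_(phi in `[0, 2 * pi]) w r phi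
       @[r --> +oo] --> 2 * L.
Proof.
move=> w.
have [g [T [gT _ _]]] := K_perimeter.
have K0 := boundary_param_nonempty R K g T K_compact gT.
have [D D0 hD'] := ht_bounded R K K_compact.
have hD phi q : K q -> `|ht R phi q| <= D by move=> /(hD' phi phi)[].
split.
  near=> r.
  apply: (integrable_visual_angle R K K_compact K0 D D0 hD r _ 0 (2 * pi)).
  by near: r; apply: nbhs_pinfty_gt; exact: num_real.
have bnd r : 2 * D < r -> _ := le_Rintegral_visual_angle R K D r L K_compact
  K_convex K0 K_perimeter D0 hD.
have L0 : 0 <= 2 * L.
  rewrite -(Rintegral_width R K L)//; apply: Rintegral_ge0 => phi _.
  by have /andP[] := width_itv R K K_compact K0 D hD phi.
apply/cvgrPdist_le => /= e e0.
near=> r.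
have rD : 2 * D < r by near: r; apply: nbhs_pinfty_gt; exact: num_real.
(* This threshold makes [D * I <= e / 3]. That is enough, since the two bounds place [2 * L] between
   [(r - 2 * D) * I] and [(r + 3 * D) * I]. *)
have rC : 2 * D + 6 * D * L / e < r.
  by near: r; apply: nbhs_pinfty_gt; exact: num_real.
have {bnd} := bnd r rD; move: (\int[_]_(_ in _) _) => I /andP[].
have a0 : 0 < r + 3 * D by lra.
have b0 : 0 < r - 2 * D by lra.
rewrite ![_^-1 * _]mulrC ler_pdivrMr// ler_pdivlMr// => lo up.
have r0 : 0 < r by lra.
have eC : 6 * D * L <= e * (r - 2 * D).
  by rewrite [e * _]mulrC -ler_pdivrMr//; lra.
have I0 : 0 <= I by rewrite -(pmulr_lge0 _ a0); lra.
have DI : D * I * (r - 2 * D) <= D * (2 * L).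
  by rewrite -mulrA ler_wpM2l// ltW.
have I2 : D * I <= e / 3.
  rewrite -(ler_pM2r b0); lra.
rewrite ler_norml; apply/andP; split; lra.
Unshelve. all: by end_near. Qed.
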